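(* Let $F$ be a linear map from an $m$-dimensional real inner product space $W$ into $\mathrm{Sym}_n^0$, and let $\lambda_1\ge\lambda_2\ge\cdots\ge\lambda_m$ be the eigenvalues of the fundamental matrix of $F$. Assume $u_1,\dots,u_m$ is an orthonormal basis of $W$ such that $\langle A_1,A_1\rangle=\lambda_1$, where $A_\alpha:=F(u_\alpha)$ for $1\le\alpha\le m$. Then $$\sum_{\alpha=2}^m\big\|[A_1,A_\alpha]\big\|^2\le\lambda_1\left(\lambda_2+\sum_{\alpha=2}^{\min\{m,n\}}\lambda_\alpha\right).$$
   Context: $\mathrm{Sym}_n^0$ is the vector space of traceless real symmetric $n\times n$ matrices, with inner product $\langle A,B\rangle=\operatorname{tr}(AB^T)$ and norm $\|A\|=\sqrt{\langle A,A\rangle}$; $[A,B]=AB-BA$. The fundamental matrix of $F$ with respect to an orthonormal basis $w_1,\dots,w_m$ of $W$ is $\big(\langle F(w_\alpha),F(w_\beta)\rangle\big)_{\alpha,\beta}$; its eigenvalues do not depend on the orthonormal basis. Convention: $\lambda_\alpha:=0$ for $\alpha>m$. *)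

(* Defs.v *)
From mathcomp Require Import all_boot all_order all_algebra.
From mathcomp Require Import reals.
Set Implicit Arguments.
Unset Strict Implicit.
Unset Printing Implicit Defensive.
Import Order.TTheory GRing.Theory Num.Theory.
Local Open Scope ring_scope.

Definition sym0mx {R : realType} (n : nat) : {pred 'M[R]_n} :=
  [pred A | (A^T == A) && (\tr A == 0)].
Arguments sym0mx {R n}.

Definition mxinner {R : realType} (n : nat) (A B : 'M[R]_n) : R :=
  \tr (A *m B^T).

Definition mxnorm {R : realType} (n : nat) (A : 'M[R]_n) : R :=
  Num.sqrt (mxinner A A).

(* [lie_bracket] avoids the ring structure, which is absent from 'M_n when the
   size n is not known to be a successor. *)
Definition lie_bracket {R : realType} (n : nat) (A B : 'M[R]_n) : 'M[R]_n :=
  A *m B - B *m A.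

(* A real inner product on W is a {dot W for idfun}: a symmetric, positive
   definite bilinear form. *)
Definition orthonormal_basis {R : realType} (W : vectType R)
    (dot : {dot W for idfun}) (w : seq W) : bool :=
  basis_of {:W} w && orthonormal dot w.

Definition fundamental_mx {R : realType} (W : vectType R) (n m : nat)
    (F : W -> 'M[R]_n) (w : m.-tuple W) : 'M[R]_m :=
  \matrix_(a, b) mxinner (F (tnth w a)) (F (tnth w b)).

(* lam lists the eigenvalues of M with multiplicity, in nonincreasing order. *)
Definition sorted_eigenvalues {R : realType} (m : nat)
    (M : 'M[R]_m) (lam : m.-tuple R) : bool :=
  sorted >=%R lam && (char_poly M == \prod_(l <- lam) ('X - l%:P)).

(* Main.v *)
Require Import Defs.
From mathcomp Require Import all_boot all_order all_algebra.
From mathcomp Require Import reals.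
From mathcomp Require Import ring lra zify complex.
Set Implicit Arguments.
Unset Strict Implicit.
Unset Printing Implicit Defensive.
Import Order.TTheory GRing.Theory Num.Theory.
Local Open Scope ring_scope.

(* Since lambda_1 is the largest eigenvalue and is attained at u_1, the
   fundamental matrix splits off a 1x1 block, so the left-hand side may be
   computed with an orthogonal family B_2, ..., B_m with |B_a|^2 = lambda_a.
   With Q_a = B_a / |B_a|, Abel summation reduces the theorem to
     sum of p terms |[A_1, Q_a]|^2 <= min(p + 1, n) |A_1|^2.
   After diagonalizing A_1 = diag(x), the left-hand side is the quadratic form
   sum_(i,j) d_ij (x_i - x_j)^2 of a weighted graph Laplacian with total weight
   at most p and, by Bessel's inequality, weights at most 1/2.  The bound p + 1
   is the Anderson-Morley estimate of its largest eigenvalue by sums of adjacent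
   degrees, and the bound n is the case of the complete graph. *)

(** * Characteristic polynomials under conjugation and block sums *)

Lemma char_poly_conj (R : comUnitRingType) (n : nat) (P Q A : 'M[R]_n) :
  P *m Q = 1%:M -> char_poly (P *m A *m Q) = char_poly A.
Proof.
move=> PQ; have QP := mulmx1C PQ.
pose p := map_mx polyC P; pose q := map_mx (@polyC R) Q.
have pq : p *m q = 1%:M by rewrite -map_mxM PQ map_mx1.
have -> : char_poly (P *m A *m Q) = \det (p *m char_poly_mx A *m q).
  rewrite /char_poly /char_poly_mx mulmxBr mulmxBl !map_mxM -/p -/q.
  by rewrite scalar_mxC -(mulmxA _ p) pq mulmx1.
by rewrite !det_mulmx mulrAC -det_mulmx pq det1 mul1r.
Qed.

Lemma char_poly_block (R : comUnitRingType) (m n : nat)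
    (a : 'M[R]_m) (B : 'M[R]_n) :
  char_poly (block_mx a 0 0 B) = char_poly a * char_poly B.
Proof.
rewrite /char_poly -(det_ublock (char_poly_mx a) 0 (char_poly_mx B)).
congr (\det _); rewrite /char_poly_mx map_block_mx !map_mx0.
by rewrite scalar_mx_block opp_block_mx add_block_mx !oppr0 !addr0.
Qed.

(** * The spectral theorem for real symmetric matrices *)

Section OrthogonalDiagonalization.
Variable R : rcfType.

Lemma row_sqnorm_ge0 (n : nat) (v : 'rV[R]_n) : 0 <= (v *m v^T) 0 0.
Proof. by rewrite mxE sumr_ge0 // => j _; rewrite mxE -expr2 sqr_ge0. Qed.

Lemma row_sqnorm_eq0 (n : nat) (v : 'rV[R]_n) :
  ((v *m v^T) 0 0 == 0) = (v == 0).
Proof.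
apply/eqP/eqP => [|->]; last by rewrite mul0mx mxE.
rewrite mxE => /eqP; rewrite psumr_eq0 => [|j _]; last by rewrite mxE -expr2 sqr_ge0.
move=> /allP v0; apply/rowP => i; have /= := v0 i (mem_index_enum _).
by rewrite mxE mulf_eq0 orbb => /eqP ->; rewrite mxE.
Qed.

(* A Householder reflection exchanging v and the first basis vector. *)
Lemma orthogonal_completion (n : nat) (v : 'rV[R]_n.+1) :
  v *m v^T = 1%:M -> exists2 H : 'M[R]_n.+1, H *m H^T = 1%:M & row 0 H = v.
Proof.
move=> vv; pose e : 'rV[R]_n.+1 := delta_mx 0 0.
have rowe (M : 'M[R]_n.+1) : row 0 M = e *m M by rewrite rowE.
have [->|vNe] := eqVneq v e.
  by exists 1%:M; rewrite ?trmx1 ?mulmx1 // rowe mulmx1.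
have ee : e *m e^T = 1%:M.
  rewrite trmx_delta mul_delta_mx; apply/matrixP=> i j.
  by rewrite !mxE !ord1.
(* Reflection along [z]: as [e] and [v] are unit vectors, [z] has squared norm [2 * c], so the usual
   factor 2 / |z|^2 is [c^-1]. *)
pose z := e - v; pose c := (e *m z^T) 0 0.
have ez : e *m z^T = c%:M by rewrite [LHS]mx11_scalar.
have ev : v *m e^T = e *m v^T.
  transitivity (e *m v^T)^T; first by rewrite trmx_mul trmxK.
  by rewrite [e *m v^T]mx11_scalar tr_scalar_mx.
have zz : z *m z^T = (2 * c)%:M.
  have -> : (2 * c)%:M = c%:M + c%:M :> 'M_1 by rewrite mulr_natl mulr2n raddfD.
  have zT : z^T = e^T - v^T by rewrite linearB.
  by rewrite -ez zT /z mulmxBl !mulmxBr ee vv ev opprB.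
have c0 : c != 0.
  apply: contraNneq vNe => c0.
  by rewrite eq_sym -subr_eq0 -/z -row_sqnorm_eq0 zz c0 mulr0 mxE.
have zE : z = e - v by [].
clearbody z; exists (1%:M - c^-1 *: (z^T *m z)).
  have trZ : (c^-1 *: (z^T *m z))^T = c^-1 *: (z^T *m z).
    by rewrite [LHS]linearZ /= trmx_mul trmxK.
  rewrite linearB /= trmx1 trZ mulmxBr mulmx1 mulmxBl mul1mx.
  rewrite -scalemxAl -scalemxAr mulmxA -(mulmxA z^T z) zz mul_mx_scalar.
  rewrite -scalemxAl !scalerA.
  suff -> : c^-1 * (c^-1 * (2 * c)) = c^-1 + c^-1.
    by rewrite scalerDl opprB addrK subrK.
  by field.
rewrite rowe mulmxBr mulmx1 -scalemxAr mulmxA ez mul_scalar_mx scalerA mulVf //.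
by rewrite scale1r zE opprB addrC subrK.
Qed.

(** Deflation: a unit eigenvector for the head of [lam] becomes the first row of an orthogonal
    matrix, symmetry splits off a 1x1 block, and induction treats the rest. Peeling [lam] in order
    keeps that order on the diagonal. *)
Lemma split_symmetric_diagonalization (n : nat) (A : 'M[R]_n) (lam : seq R) :
    A^T = A -> char_poly A = \prod_(l <- lam) ('X - l%:P) ->
  exists2 P : 'M[R]_n, P *m P^T = 1%:M
    & P *m A *m P^T = diag_mx (\row_i lam`_i).
Proof.
elim: n => [|n IHn] in A lam *.
  by move=> _ _; exists 1%:M; rewrite [LHS]flatmx0 [RHS]flatmx0.
move=> symA; case: lam => [/(congr1 (fun p : {poly R} => size p))|l lam chA].
  by rewrite size_char_poly big_nil size_poly1.
have /eigenvalueP[v vA v0] : eigenvalue A l.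
  by rewrite eigenvalue_root_char chA big_cons rootM root_XsubC eqxx.
pose c := (v *m v^T) 0 0.
have vvc : v *m v^T = c%:M by rewrite [LHS]mx11_scalar.
have c_gt0 : 0 < c.
  by rewrite lt0r row_sqnorm_ge0 row_sqnorm_eq0 v0.
pose v1 := (Num.sqrt c)^-1 *: v.
have [|H HH H0] := @orthogonal_completion _ v1.
  rewrite linearZ /= -scalemxAl -scalemxAr vvc scalerA -invfM.
  rewrite -expr2 sqr_sqrtr ?ltW //.
  by rewrite scale_scalar_mx mulVf // gt_eqF.
pose B : 'M[R]_(1 + n) := H *m A *m H^T.
have symB : B^T = B by rewrite !trmx_mul trmxK symA mulmxA.
have B0 : row 0 B = l *: delta_mx 0 0.
  rewrite !row_mul H0 -scalemxAl vA scalerA mulrC -scalerA -/v1 -scalemxAl -H0.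
  by rewrite -row_mul HH row1.
have BE : B = H *m A *m H^T by [].
clearbody B; have B0E j : B 0 j = l * (j == 0)%:R.
  by move/rowP/(_ j): B0; rewrite !mxE.
have Bblock : B = block_mx l%:M 0 0 (drsubmx B).
  have shift0 : lshift n (0 : 'I_1) = 0 :> 'I_(1 + n) by apply: val_inj.
  rewrite -[LHS]submxK; congr block_mx; apply/matrixP=> i j.
  - by rewrite !ord1 !mxE shift0 B0E mulr1.
  - by rewrite !ord1 !mxE shift0 B0E mulr0.
  - by rewrite !ord1 -[in LHS]symB !mxE shift0 B0E mulr0.
have [||P PP PB] := IHn (drsubmx B) lam.
- by rewrite -[in RHS]symB trmx_drsub.
- have := char_poly_conj A HH; rewrite -BE chA big_cons.
  rewrite -[char_poly B]/(char_poly (B : 'M_(1 + n))) {1}Bblock char_poly_block.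
  rewrite {1}/char_poly {1}/char_poly_mx det_mx11 !mxE eqxx /=.
  by apply: mulfI; rewrite polyXsubC_eq0.
pose Q : 'M[R]_(1 + n) := block_mx 1%:M 0 0 P.
have QQ : Q *m Q^T = 1%:M.
  rewrite tr_block_mx !trmx0 trmx1 mulmx_block !mulmx0 !mul0mx !addr0.
  by rewrite !add0r mulmx1 PP -scalar_mx_block.
exists ((Q : 'M_n.+1) *m H).
  by rewrite trmx_mul mulmxA -(mulmxA Q) HH mulmx1.
have -> : (Q : 'M_n.+1) *m H *m A *m (Q *m H)^T = Q *m B *m Q^T.
  by rewrite BE trmx_mul !mulmxA.
rewrite Bblock tr_block_mx !trmx0 trmx1 !mulmx_block !mulmx0 !mul0mx.
rewrite !addr0 !add0r mulmx1 mul1mx !mul0mx PB; apply/matrixP => i j; rewrite !mxE.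
case: splitP => i' ei; rewrite !mxE; case: splitP => j' ej; rewrite !mxE.
- by rewrite -!val_eqE /= ei ej !ord1.
- by rewrite -val_eqE /= ei ej !ord1.
- by rewrite -val_eqE /= ei ej !ord1.
- by rewrite -!val_eqE /= ei ej /=.
Qed.

(** It suffices to split the characteristic polynomial over [R]. Over [R[i]] the matrix is
    hermitian, hence diagonalizable with real spectrum, and the factorization descends because [toC]
    is injective on polynomials. *)
Lemma symmetric_diagonalization (n : nat) (A : 'M[R]_n) :
    A^T = A ->
  exists P : 'M[R]_n, exists2 d : 'rV[R]_n,
    P *m P^T = 1%:M & P *m A *m P^T = diag_mx d.
Proof.
move=> symA; pose toC : {rmorphism R -> R[i]} := real_complex R.
pose B := map_mx toC A.
have hermB : B \is hermsymmx.
  apply: realsym_hermsym.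
    apply/is_hermitianmxP; rewrite expr0 scale1r map_mx_id //.
    by rewrite /B map_trmx symA.
  by apply/mxOverP => i j; rewrite mxE; apply/complex_realP; exists (A i j).
have realS := hermitian_spectral_diag_real hermB.
have /hermitian_normalmx/orthomx_spectralP eB := hermB.
pose s := [seq complex.Re (spectral_diag B 0 i) | i <- enum 'I_n].
have [|P PP PA] := split_symmetric_diagonalization (lam := s) symA;
  last by exists P, (\row_i s`_i).
apply: (map_poly_inj toC); rewrite map_char_poly -/B [B in LHS]eB.
rewrite char_poly_conj; last first.
  by rewrite mulVmx // spectral_unit.
rewrite char_poly_trig ?diag_mx_is_trig // rmorph_prod /= big_map big_enum /=.
apply: eq_bigr => i _; rewrite rmorphB /= map_polyX map_polyC /= mxE eqxx mulr1n.
by congr ('X - _%:P); rewrite RRe_real // (mxOverP realS).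
Qed.

End OrthogonalDiagonalization.

(** * Upper bounds for a weighted graph Laplacian *)

Section WeightedLaplacian.
Variable R : realFieldType.

(** Weighted Cauchy-Schwarz: the weighted sum of the [(t - y i) ^+ 2] is a nonnegative quadratic in
    [t], evaluated at its minimum [g / D]. *)
Lemma weighted_sqr_sum_le (I : finType) (d y : I -> R) :
    (forall i, 0 <= d i) ->
  (\sum_i d i * y i) ^+ 2 <= (\sum_i d i) * \sum_i d i * y i ^+ 2.
Proof.
move=> d0; set D := \sum_i d i; set g := \sum_i d i * y i.
set S := \sum_i d i * y i ^+ 2.
have D0 : 0 <= D by apply: sumr_ge0.
have q t : 0 <= t ^+ 2 * D - 2 * t * g + S.
  have -> : t ^+ 2 * D - 2 * t * g + S = \sum_i d i * (t - y i) ^+ 2.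
    rewrite !mulr_sumr -sumrB -big_split /=; apply: eq_bigr => i _; ring.
  by apply: sumr_ge0 => i _; rewrite mulr_ge0 ?sqr_ge0.
have [DE|D_neq0] := eqVneq D 0.
  have d_eq0 i : d i = 0.
    by move/eqP: DE; rewrite psumr_eq0 // => /allP/(_ i (mem_index_enum _))/eqP.
  by rewrite /g big1 ?expr0n ?DE ?mul0r // => i _; rewrite d_eq0 mul0r.
have D_gt0 : 0 < D by rewrite lt0r D_neq0.
have := q (g / D).
have -> : (g / D) ^+ 2 * D - 2 * (g / D) * g + S = (D * S - g ^+ 2) / D.
  by field.
by rewrite pmulr_lge0 ?invr_gt0 // subr_ge0.
Qed.

(** The double sum counts every edge meeting [i] or [j] twice, once per orientation. Only the edge
    between [i] and [j] lies in both degrees, hence the correction [2 * d i j]. *)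
Lemma weighted_degree_le (n : nat) (d : 'I_n -> 'I_n -> R) (i j : 'I_n) :
    (forall i j, d i j = d j i) -> (forall i, d i i = 0) ->
    (forall i j, 0 <= d i j) -> i != j ->
  2 * (\sum_k d i k + \sum_k d j k) <= \sum_i \sum_j d i j + 2 * d i j.
Proof.
move=> symd d0 d_ge0 nij.
have ji : j != i by rewrite eq_sym.
have rest : \sum_(k | (k != i) && (k != j)) (d i k + d j k)
   <= \sum_(k | (k != i) && (k != j)) \sum_l d k l.
  apply: ler_sum => k /andP[ki kj].
  rewrite (bigD1 i) //= (bigD1 j) //= (symd i k) (symd j k) addrA lerDl.
  by apply: sumr_ge0.
have split (f : 'I_n -> R) :
    \sum_k f k = f i + f j + \sum_(k | (k != i) && (k != j)) f k.
  by rewrite (bigD1 i) //= (bigD1 j) //= addrA.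
rewrite (split (fun k => \sum_l d k l)) /=.
rewrite big_split /= in rest.
have := split (d i); have := split (d j); rewrite !d0 (symd j i).
lra.
Qed.

(* Write the form as [2 sum_i x i * g i]; by Cauchy-Schwarz
   [g i ^+ 2 <= D i * S i], where [D i] is the degree of [i] and [S i] its share
   of the form, and symmetrizing turns [D i] into [D i + D j] on the edges. *)
Lemma weighted_laplacian_le (n : nat) (d : 'I_n -> 'I_n -> R) (x : 'I_n -> R)
    (c : R) :
    (forall i j, d i j = d j i) -> (forall i, d i i = 0) ->
    (forall i j, 0 <= d i j) -> (forall i j, 2 * d i j <= 1) ->
    \sum_i \sum_j d i j <= c ->
  \sum_i \sum_j d i j * (x i - x j) ^+ 2 <= (c + 1) * \sum_i x i ^+ 2.
Proof.
move=> symd d0 d_ge0 d_le dc.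
pose D i := \sum_j d i j.
pose g i := \sum_j d i j * (x i - x j).
pose S := \sum_i \sum_j d i j * (x i - x j) ^+ 2.
rewrite -/S; set X := \sum_i _.
have c_ge0 : 0 <= c.
  by apply: le_trans dc; do 2![apply: sumr_ge0 => ? _].
have Sg : S = 2 * \sum_i x i * g i.
  have -> : S = \sum_i x i * g i - \sum_i \sum_j d i j * (x i - x j) * x j.
    rewrite -sumrB; apply: eq_bigr => i _.
    rewrite mulr_sumr -sumrB; apply: eq_bigr => j _; ring.
  suff -> : \sum_i \sum_j d i j * (x i - x j) * x j = - \sum_i x i * g i by ring.
  rewrite exchange_big -sumrN /=; apply: eq_bigr => i _.
  rewrite mulr_sumr -sumrN; apply: eq_bigr => j _; rewrite (symd j i); ring.
have gS : 4 * \sum_i g i ^+ 2 <= (c + 1) * S.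
  have : \sum_i g i ^+ 2 <= \sum_i D i * \sum_j d i j * (x i - x j) ^+ 2.
    by apply: ler_sum => i _; apply: weighted_sqr_sum_le.
  set T := \sum_i D i * _ => gT.
  have T2 : 2 * T = \sum_i \sum_j (D i + D j) * (d i j * (x i - x j) ^+ 2).
    transitivity (T + \sum_i \sum_j D j * (d i j * (x i - x j) ^+ 2)).
      rewrite mulr_natl mulr2n; congr (_ + _); rewrite exchange_big.
      apply: eq_bigr => i _; rewrite mulr_sumr; apply: eq_bigr => j _.
      by rewrite (symd i j) -(opprB (x i)) sqrrN.
    rewrite -big_split; apply: eq_bigr => i _ /=.
    by rewrite mulr_sumr -big_split; apply: eq_bigr => j _; rewrite mulrDl.
  have : 4 * T <= (c + 1) * S.
    have -> : 4 * T = 2 * (2 * T) by ring.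
    rewrite T2 !mulr_sumr; apply: ler_sum => i _.
    rewrite !mulr_sumr; apply: ler_sum => j _.
    have [->|nij] := eqVneq i j; first by rewrite subrr expr0n !mulr0.
    rewrite mulrA ler_wpM2r 1?mulr_ge0 ?sqr_ge0 //.
    (* Twice the degree sum is at most the total weight plus [2 * d i j], hence at most [c + 1]. *)
    have := weighted_degree_le symd d0 d_ge0 nij.
    have := d_le i j; rewrite -/(D i) -/(D j). lra.
  lra.
have c1 : 0 < c + 1 by lra.
suff : (c + 1) * S <= (c + 1) * ((c + 1) * X) by rewrite ler_pM2l.
(* Expanding these squares and inserting [gS] leaves [0 <= (c + 1) ^+ 2 * X - (c + 1) * S]. *)
have : 0 <= \sum_i ((c + 1) * x i - 2 * g i) ^+ 2.
  by apply: sumr_ge0 => i _; exact: sqr_ge0.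
have -> : \sum_i ((c + 1) * x i - 2 * g i) ^+ 2 =
   (c + 1) ^+ 2 * X - (c + 1) * (2 * (2 * \sum_i x i * g i)) + 4 * \sum_i g i ^+ 2.
  rewrite !mulr_sumr -sumrB -big_split; apply: eq_bigr => i _ /=; ring.
rewrite -Sg expr2; lra.
Qed.

(** The Laplacian form of the complete graph; dropping the square of the sum of the [x i] gives the
    bound with factor [n]. *)
Lemma sum_sqr_diff (n : nat) (x : 'I_n -> R) :
  \sum_i \sum_j (x i - x j) ^+ 2
  = 2 * n%:R * \sum_i x i ^+ 2 - 2 * (\sum_i x i) ^+ 2.
Proof.
pose X := \sum_i x i ^+ 2; pose s := \sum_i x i; rewrite -/X -/s.
transitivity (\sum_i (n%:R * x i ^+ 2 + X - 2 * s * x i)).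
  apply: eq_bigr => i _.
  have -> : n%:R * x i ^+ 2 = \sum_(j < n) x i ^+ 2.
    by rewrite sumr_const card_ord mulr_natl.
  rewrite mulrAC -mulrA !mulr_sumr -big_split -sumrB; apply: eq_bigr => j _ /=; ring.
rewrite sumrB big_split /= -!mulr_sumr sumr_const card_ord -mulr_natl -/X -/s; ring.
Qed.

End WeightedLaplacian.

(** * Frobenius inner product and brackets with an orthogonal family *)

Section FrobeniusInner.
Variables (R : realType) (n : nat).
Implicit Types A B C P Q : 'M[R]_n.

Lemma mxinnerE A B : mxinner A B = \sum_i \sum_j A i j * B i j.
Proof.
rewrite /mxinner /mxtrace; apply: eq_bigr => i _; rewrite mxE.
by apply: eq_bigr => j _; rewrite mxE.
Qed.

Lemma mxinnerC A B : mxinner A B = mxinner B A.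
Proof. by rewrite /mxinner -mxtrace_tr trmx_mul trmxK. Qed.

Lemma mxinnerZl a A B : mxinner (a *: A) B = a * mxinner A B.
Proof. by rewrite /mxinner -scalemxAl mxtraceZ. Qed.

Lemma mxinnerZr a A B : mxinner A (a *: B) = a * mxinner A B.
Proof. by rewrite mxinnerC mxinnerZl mxinnerC. Qed.

Lemma mxinner_suml (I : finType) (X : I -> 'M[R]_n) B :
  mxinner (\sum_i X i) B = \sum_i mxinner (X i) B.
Proof. by rewrite /mxinner mulmx_suml raddf_sum. Qed.

Lemma mxinner_sumr (I : finType) (X : I -> 'M[R]_n) B :
  mxinner B (\sum_i X i) = \sum_i mxinner B (X i).
Proof.
by rewrite mxinnerC mxinner_suml; apply: eq_bigr => i _; rewrite mxinnerC.
Qed.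

Lemma mxinner_ge0 A : 0 <= mxinner A A.
Proof.
by rewrite mxinnerE; do 2![apply: sumr_ge0 => ? _]; rewrite -expr2 sqr_ge0.
Qed.

Lemma mxinner_eq0 A : mxinner A A = 0 -> A = 0.
Proof.
rewrite mxinnerE => /eqP; rewrite psumr_eq0 => [|i _]; last first.
  by apply: sumr_ge0 => ? _; rewrite -expr2 sqr_ge0.
move=> /allP A0; apply/matrixP => i j.
have /= := A0 i (mem_index_enum _); rewrite psumr_eq0 => [|k _].
  by move=> /allP/(_ j (mem_index_enum _)) /=; rewrite mulf_eq0 orbb mxE => /eqP.
by rewrite -expr2 sqr_ge0.
Qed.

Lemma sqr_mxnorm A : mxnorm A ^+ 2 = mxinner A A.
Proof. by rewrite sqr_sqrtr // mxinner_ge0. Qed.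

Lemma mxinner_conj P A B :
  P *m P^T = 1%:M -> mxinner (P *m A *m P^T) (P *m B *m P^T) = mxinner A B.
Proof.
move=> PP; have PP' := mulmx1C PP.
rewrite /mxinner !trmx_mul trmxK !mulmxA -(mulmxA _ P^T P) PP' mulmx1.
by rewrite mxtrace_mulC !mulmxA PP' mul1mx.
Qed.

Lemma lie_bracket_conj P A B : P *m P^T = 1%:M ->
  lie_bracket (P *m A *m P^T) (P *m B *m P^T) = P *m lie_bracket A B *m P^T.
Proof.
move=> /mulmx1C PP.
rewrite /lie_bracket !mulmxA -(mulmxA _ P^T P) -(mulmxA (P *m B) P^T P) PP !mulmx1.
by rewrite mulmxBr mulmxBl !mulmxA.
Qed.

Lemma lie_bracketZr a A B : lie_bracket A (a *: B) = a *: lie_bracket A B.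
Proof. by rewrite /lie_bracket -scalemxAr -scalemxAl scalerBr. Qed.

Lemma lie_bracket_sumr (I : finType) A (X : I -> 'M[R]_n) :
  lie_bracket A (\sum_i X i) = \sum_i lie_bracket A (X i).
Proof. by rewrite /lie_bracket mulmx_sumr mulmx_suml -sumrB. Qed.

(** Bessel's inequality, from expanding |A - Y|^2 >= 0. Norms at most 1, rather than equal to 1,
    admit zero members, which arise from vanishing eigenvalues. *)
Lemma bessel_le (I : finType) (P : pred I) (Q : I -> 'M[R]_n) A :
    (forall k l, k != l -> mxinner (Q k) (Q l) = 0) ->
    (forall k, mxinner (Q k) (Q k) <= 1) ->
  \sum_(k | P k) mxinner (Q k) A ^+ 2 <= mxinner A A.
Proof.
move=> ortho unit.
pose c k := (P k)%:R * mxinner (Q k) A.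
have -> : \sum_(k | P k) mxinner (Q k) A ^+ 2 = \sum_k c k ^+ 2.
  rewrite big_mkcond; apply: eq_bigr => k _; rewrite /c.
  by case: (P k); rewrite ?mul1r // mul0r expr0n.
pose Y := \sum_k c k *: Q k.
have YA : mxinner Y A = \sum_k c k ^+ 2.
  rewrite mxinner_suml; apply: eq_bigr => k _; rewrite mxinnerZl /c.
  by case: (P k); rewrite ?mul1r // !mul0r expr0n.
have YY : mxinner Y Y <= \sum_k c k ^+ 2.
  rewrite {1}/Y mxinner_suml; apply: ler_sum => k _.
  rewrite mxinnerZl mxinner_sumr (bigD1 k) //= big1 => [|l lk].
    rewrite addr0 mxinnerZr mulrA -expr2 ler_piMr ?sqr_ge0 //.
  by rewrite mxinnerZr ortho 1?eq_sym // mulr0.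
have := mxinner_ge0 (A - Y).
have -> : mxinner (A - Y) (A - Y) = mxinner A A - 2 * mxinner Y A + mxinner Y Y.
  have -> : A - Y = A + (-1) *: Y by rewrite scaleN1r.
  have D U V Z : mxinner (U + V) Z = mxinner U Z + mxinner V Z.
    by rewrite /mxinner mulmxDl mxtraceD.
  rewrite D mxinnerZl !(mxinnerC _ (A + _)) !D !mxinnerZl (mxinnerC A Y); ring.
rewrite YA; lra.
Qed.

Lemma sum_sqr_lie_bracket_diag_le (I : finType) (P : pred I) (Q : I -> 'M[R]_n)
    (x : 'rV[R]_n) :
    (forall k, (Q k)^T = Q k) ->
    (forall k l, k != l -> mxinner (Q k) (Q l) = 0) ->
    (forall k, mxinner (Q k) (Q k) <= 1) ->
  let S := \sum_(k | P k) mxnorm (lie_bracket (diag_mx x) (Q k)) ^+ 2 in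
  let X := mxinner (diag_mx x) (diag_mx x) in
  S <= (#|P|%:R + 1) * X /\ S <= n%:R * X.
Proof.
move=> symQ ortho unit S X.
pose d i j := \sum_(k | P k) Q k i j ^+ 2.
have XE : X = \sum_i x 0 i ^+ 2.
  rewrite /X mxinnerE; apply: eq_bigr => i _.
  rewrite (bigD1 i) //= big1 => [|j ji]; last first.
    by rewrite !mxE eq_sym (negPf ji) mul0r.
  by rewrite !mxE eqxx mulr1n addr0 expr2.
have SE : S = \sum_i \sum_j d i j * (x 0 i - x 0 j) ^+ 2.
  rewrite /S; under eq_bigr do rewrite sqr_mxnorm mxinnerE.
  rewrite exchange_big; apply: eq_bigr => i _ /=.
  rewrite exchange_big; apply: eq_bigr => j _ /=.
  rewrite mulr_suml; apply: eq_bigr => k _.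
  have -> : lie_bracket (diag_mx x) (Q k) i j = (x 0 i - x 0 j) * Q k i j.
    rewrite /lie_bracket mul_diag_mx mul_mx_diag !mxE; ring.
  ring.
have d_ge0 i j : 0 <= d i j by apply: sumr_ge0 => k _; exact: sqr_ge0.
have d_sym i j : d i j = d j i.
  by apply: eq_bigr => k _; rewrite -[in LHS]symQ mxE.
have d_le i j : i != j -> 2 * d i j <= 1.
  (* Bessel is tested on [E]: its squared norm is 2 and its inner product with [Q k] is
     [2 * Q k i j], whence [4 * d i j <= 2]. *)
  move=> nij; pose E : 'M[R]_n := delta_mx i j + delta_mx j i.
  have QE A : mxinner A E = A i j + A j i.
    rewrite /mxinner linearD /= !trmx_delta mulmxDr mxtraceD.
    have tr a b : \tr (A *m delta_mx a b) = A b a.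
      rewrite mxtrace_mulC /mxtrace (bigD1 a) //= big1 => [|k ka].
        rewrite mxE (bigD1 b) //= big1 => [|l lb].
          by rewrite mxE !eqxx mul1r !addr0.
        by rewrite mxE (negPf lb) andbF mul0r.
      by rewrite mxE big1 // => l _; rewrite mxE (negPf ka) mul0r.
    by rewrite !tr.
  have EE : mxinner E E = 2.
    by rewrite QE !mxE !eqxx (negPf nij) eq_sym (negPf nij) /= add0r addr0.
  have := bessel_le P E ortho unit; rewrite EE.
  have -> : \sum_(k | P k) mxinner (Q k) E ^+ 2 = 4 * d i j.
    rewrite mulr_sumr; apply: eq_bigr => k _; rewrite QE.
    have -> : Q k j i = Q k i j by rewrite -[in LHS]symQ mxE.
    ring.
  lra.
(* Loops contribute nothing to the form but may weigh more than 1/2, so they are removed. *)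
pose d' i j := if i == j then 0 else d i j.
have SE' : S = \sum_i \sum_j d' i j * (x 0 i - x 0 j) ^+ 2.
  rewrite SE; do 2![apply: eq_bigr => ? _]; rewrite /d'.
  by case: eqP => [->|//]; rewrite subrr expr0n !mulr0.
have d'_le i j : 2 * d' i j <= 1.
  by rewrite /d'; case: ifP => [_|/negbT /d_le //]; rewrite mulr0.
split.
  rewrite SE' XE; apply: weighted_laplacian_le => //.
  - by move=> i j; rewrite /d' eq_sym d_sym.
  - by move=> i; rewrite /d' eqxx.
  - by move=> i j; rewrite /d'; case: ifP.
  apply: (@le_trans _ _ (\sum_i \sum_j d i j)).
    by do 2![apply: ler_sum => ? _]; rewrite /d'; case: ifP.
  (* The total weight is the sum of the squared norms of the [Q k], at most the number of terms. *)
  have -> : \sum_i \sum_j d i j = \sum_(k | P k) mxinner (Q k) (Q k).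
    rewrite /d; under eq_bigr do rewrite exchange_big /=.
    rewrite exchange_big; apply: eq_bigr => k _; rewrite mxinnerE.
    by do 2![apply: eq_bigr => ? _]; rewrite expr2.
  by rewrite -sum1_card natr_sum; apply: ler_sum => k _.
(* Weights at most 1/2 make the complete graph form dominate [2 * S]. *)
have : 2 * S <= \sum_i \sum_j (x 0 i - x 0 j) ^+ 2.
  rewrite SE' mulr_sumr; apply: ler_sum => i _; rewrite mulr_sumr.
  by apply: ler_sum => j _; rewrite mulrA ler_piMl ?sqr_ge0.
rewrite sum_sqr_diff -XE.
have := sqr_ge0 (\sum_i x 0 i); lra.
Qed.

(** Orthogonal conjugation preserves inner products and is compatible with brackets, so [A] may be
    taken diagonal. *)
Lemma sum_sqr_lie_bracket_le (I : finType) (P : pred I) (A : 'M[R]_n)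
    (Q : I -> 'M[R]_n) :
    A^T = A -> (forall k, (Q k)^T = Q k) ->
    (forall k l, k != l -> mxinner (Q k) (Q l) = 0) ->
    (forall k, mxinner (Q k) (Q k) <= 1) ->
  let S := \sum_(k | P k) mxnorm (lie_bracket A (Q k)) ^+ 2 in
  S <= (#|P|%:R + 1) * mxinner A A /\ S <= n%:R * mxinner A A.
Proof.
move=> symA symQ ortho unit; have [U [x UU UA]] := symmetric_diagonalization symA.
pose Q' k := U *m Q k *m U^T.
have [||| ] := @sum_sqr_lie_bracket_diag_le I P Q' x.
- by move=> k; rewrite !trmx_mul trmxK symQ mulmxA.
- by move=> k l kl; rewrite mxinner_conj // ortho.
- by move=> k; rewrite mxinner_conj.
rewrite -UA mxinner_conj //=.
under eq_bigr do rewrite sqr_mxnorm lie_bracket_conj // mxinner_conj // -sqr_mxnorm.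
by [].
Qed.

End FrobeniusInner.

(** Abel summation by induction on [p]: [f p] times the partial sum stays below the weighted sum,
    since replacing [f p.+1] by the larger [f p] is harmless when the partial sum is nonnegative. *)
Lemma abel_sum_ge0 (R : realDomainType) (N : nat) (f : nat -> R) (r : 'I_N -> R) :
    (forall k, f k.+1 <= f k) -> 0 <= f N ->
    (forall p, (p <= N)%N -> 0 <= \sum_(k < N | (k < p)%N) r k) ->
  0 <= \sum_(k < N) f k * r k.
Proof.
move=> f_dec fN r_ge0.
suff main p : (p <= N)%N ->
    f p * \sum_(k < N | (k < p)%N) r k <= \sum_(k < N | (k < p)%N) f k * r k.
  have big_lt (g : 'I_N -> R) : \sum_(k < N) g k = \sum_(k < N | (k < N)%N) g k.
    by apply: eq_bigl => k; rewrite ltn_ord.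
  by rewrite big_lt; apply: le_trans (main N _); rewrite ?mulr_ge0 ?r_ge0.
elim: p => [_|p IHp pN]; first by rewrite !big_pred0 ?mulr0.
have step (g : 'I_N -> R) : \sum_(k < N | (k < p.+1)%N) g k =
    \sum_(k < N | (k < p)%N) g k + \sum_(k < N | k == p :> nat) g k.
  rewrite (bigID (fun k : 'I_N => (k < p)%N)) /=; congr (_ + _).
    by apply: eq_bigl => k; rewrite andb_idl // => /ltnW.
  by apply: eq_bigl => k; rewrite -leqNgt ltnS eqn_leq.
apply: (@le_trans _ _ (f p * \sum_(k < N | (k < p.+1)%N) r k)).
  by rewrite ler_wpM2r ?r_ge0.
rewrite !step mulrDr lerD ?IHp 1?ltnW // le_eqVlt; apply/orP; left; apply/eqP.
by rewrite mulr_sumr; apply: eq_bigr => k /eqP ->.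
Qed.

(** * Change of orthonormal basis *)

Section OrthonormalBases.
Variables (R : realType) (W : vectType R) (dot : {dot W for idfun}) (m : nat).

Lemma orthonormal_nthE (w : seq W) : orthonormal dot w ->
  forall i j, (i < size w)%N -> (j < size w)%N -> dot w`_i w`_j = (i == j)%:R.
Proof.
case/andP=> /allP w1 ow.
have symdot x y : dot x y = dot y x by rewrite hermC expr0 mul1r.
suff lt_case i j : (i < j)%N -> (j < size w)%N -> dot w`_i w`_j = 0.
  move=> i j iw jw; case: (ltngtP i j) => [ij|ji|->].
  - exact: lt_case.
  - by rewrite symdot lt_case.
  - by apply/eqP/w1; rewrite mem_nth.
elim: w ow i j {w1} => //= x w IHw /andP[/andP[/allP xw _] ow] [|i] [|j] //=.
  by move=> _ jw; apply/eqP/xw; rewrite mem_nth.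
by move=> ij jw; apply: IHw.
Qed.

(** The coordinates of [u] in the basis [w] form an orthogonal matrix. This carries the spectrum
    given for [w] over to [u]. *)
Lemma fundamental_mx_conj (n : nat) (F : {linear W -> 'M[R]_n}) (w u : m.-tuple W) :
    orthonormal_basis dot w -> orthonormal_basis dot u ->
  exists2 O : 'M[R]_m, O *m O^T = 1%:M
    & fundamental_mx F u = O *m fundamental_mx F w *m O^T.
Proof.
move=> /andP[bw ow] /andP[bu ou].
have dotE (s : m.-tuple W) (os : orthonormal dot s) (a b : 'I_m) :
    dot (tnth s a) (tnth s b) = (a == b)%:R.
  by rewrite !(tnth_nth 0) (orthonormal_nthE os) ?size_tuple.
pose O : 'M[R]_m := \matrix_(a, b) coord w b (tnth u a).
have uE a : tnth u a = \sum_b O a b *: tnth w b.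
  have : tnth u a \in <<w>>%VS by rewrite (span_basis bw) memvf.
  move/coord_span => {1}->; apply: eq_bigr => b _; rewrite mxE.
  by rewrite -tnth_nth.
exists O.
  apply/matrixP => a b; rewrite !mxE -(dotE u ou).
  rewrite [in RHS]uE linear_sumlz; apply: eq_bigr => c _.
  rewrite linearZl_LR /= [in RHS]uE linear_sumr (bigD1 c) //= big1 => [|d dc].
    by rewrite linearZr_LR /= (dotE w ow) eqxx mulr1 addr0 [O^T _ _]mxE.
  by rewrite linearZr_LR /= (dotE w ow) eq_sym (negPf dc) mulr0.
apply/matrixP => a b; rewrite mxE !uE !linear_sum mxinner_suml.
under eq_bigr do rewrite mxinner_sumr.
rewrite exchange_big [RHS]mxE; apply: eq_bigr => d _ /=.
rewrite [(O *m _) _ _]mxE mulr_suml; apply: eq_bigr => c _.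
by rewrite !linearZ mxinnerZl mxinnerZr !mxE; ring.
Qed.

End OrthonormalBases.

(** * Splitting the largest eigenvalue off the fundamental matrix *)

Lemma fundamental_mx_sym (R : realType) (W : vectType R) (n m : nat)
  (F : W -> 'M[R]_n) (w : m.-tuple W) : (fundamental_mx F w)^T = fundamental_mx F w.
Proof. by apply/matrixP => a b; rewrite !mxE mxinnerC. Qed.

(** [M 0 0] is a mean of the eigenvalues with weights [P k 0 ^+ 2]. A mean equal to the maximum puts
    all weight on the top eigenvalue, so the first basis vector is an eigenvector. *)
Lemma top_diagonal_entry_split (R : rcfType) (m : nat) (M : 'M[R]_(1 + m))
    (lam : seq R) :
    M^T = M -> sorted >=%R lam -> char_poly M = \prod_(l <- lam) ('X - l%:P) ->
    M 0 0 = lam`_0 ->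
  M = block_mx (lam`_0)%:M 0 0 (drsubmx M).
Proof.
move=> symM sl chM M00.
have szl : size lam = m.+1.
  have := congr1 (fun p : {poly R} => size p) chM.
  by rewrite size_char_poly size_prod_XsubC => -[].
have [P PP PM] := split_symmetric_diagonalization symM chM.
have PP' := mulmx1C PP.
have ME : M = P^T *m diag_mx (\row_i lam`_i) *m P.
  by rewrite -PM !mulmxA PP' mul1mx -mulmxA PP' mulmx1.
have MijE i j : M i j = \sum_(k < 1 + m) lam`_k * (P k i * P k j).
  rewrite {1}ME mxE; apply: eq_bigr => k _.
  by rewrite mul_mx_diag !mxE mulrCA mulrA.
have PijE i j : \sum_k P k i * P k j = (i == j)%:R.
  move/matrixP/(_ i j): PP'; rewrite !mxE => <-.
  by apply: eq_bigr => k _; rewrite mxE.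
have lam_le k : (k < m.+1)%N -> lam`_k <= lam`_0.
  by move=> km; apply: (sorted_leq_nth ge_trans (@lexx _ _)); rewrite ?inE ?szl.
have lamP (k : 'I_(1 + m)) : lam`_k * P k 0 = lam`_0 * P k 0.
  have : \sum_(k < 1 + m) (lam`_0 - lam`_k) * P k 0 ^+ 2 == 0.
    under eq_bigr do rewrite mulrBl expr2.
    by rewrite sumrB -mulr_sumr PijE mulr1 -MijE M00 subrr.
  rewrite psumr_eq0 => [/allP/(_ k (mem_index_enum _)) /=|l _]; last first.
    by rewrite mulr_ge0 ?sqr_ge0 // subr_ge0 lam_le.
  rewrite mulf_eq0 sqrf_eq0 subr_eq0 => /orP[/eqP <- //|/eqP ->].
  by rewrite !mulr0.
have M0E j : M 0 j = lam`_0 * (j == 0)%:R.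
  rewrite MijE eq_sym -PijE mulr_sumr; apply: eq_bigr => k _.
  by rewrite mulrA lamP mulrA.
have shift0 : lshift m (0 : 'I_1) = 0 :> 'I_(1 + m) by apply: val_inj.
rewrite -[LHS]submxK; congr block_mx; apply/matrixP=> i j.
- by rewrite !ord1 [LHS]mxE [LHS]mxE !mxE shift0 M0E mulr1.
- by rewrite !ord1 [LHS]mxE [LHS]mxE !mxE shift0 M0E mulr0.
- by rewrite !ord1 -[in LHS]symM [LHS]mxE [LHS]mxE !mxE shift0 M0E mulr0.
Qed.

(** By the block form, cancelling the first linear factor leaves the characteristic polynomial of
    the lower block, with the tail of [lam] as roots. *)
Lemma tail_diagonalization (R : rcfType) (m : nat) (M : 'M[R]_(1 + m))
    (lam : seq R) :
    M^T = M -> sorted >=%R lam -> char_poly M = \prod_(l <- lam) ('X - l%:P) ->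
    M 0 0 = lam`_0 ->
  exists2 P : 'M[R]_m, P *m P^T = 1%:M
    & P *m drsubmx M *m P^T = diag_mx (\row_i lam`_i.+1).
Proof.
move=> symM sl chM M00.
have MB := top_diagonal_entry_split symM sl chM M00.
case: lam => [|l lam] in sl chM M00 MB *.
  have := congr1 (fun p : {poly R} => size p) chM.
  by rewrite size_char_poly big_nil size_poly1.
apply: split_symmetric_diagonalization; first by rewrite -[in RHS]symM trmx_drsub.
move: chM; rewrite MB char_poly_block big_cons block_mxKdr.
rewrite {1}/char_poly {1}/char_poly_mx det_mx11 !mxE eqxx /=.
by apply: mulfI; rewrite polyXsubC_eq0.
Qed.

(** * Reduction to an orthogonal family *)

Lemma sum_sqr_mxnorm_orthogonal (R : realType) (m n : nat) (P : 'M[R]_m)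
    (X : 'I_m -> 'M[R]_n) :
  P *m P^T = 1%:M ->
  \sum_a mxnorm (X a) ^+ 2 = \sum_b mxnorm (\sum_a P b a *: X a) ^+ 2.
Proof.
move=> /mulmx1C PP.
have PijE i j : \sum_k P k i * P k j = (i == j)%:R.
  move/matrixP/(_ i j): PP; rewrite !mxE => <-.
  by apply: eq_bigr => k _; rewrite mxE.
under [in RHS]eq_bigr do rewrite sqr_mxnorm mxinner_suml.
rewrite exchange_big; apply: eq_bigr => a _ /=.
under eq_bigr do rewrite mxinner_sumr.
rewrite exchange_big (bigD1 a) //= [X in _ + X]big1 => [|c ca].
  under eq_bigr do rewrite mxinnerZl mxinnerZr mulrA.
  by rewrite -mulr_suml PijE eqxx mul1r addr0 sqr_mxnorm.
under eq_bigr do rewrite mxinnerZl mxinnerZr mulrA.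
by rewrite -mulr_suml PijE eq_sym (negPf ca) mul0r.
Qed.

(** Here [lam k] stands for lambda_(k+2). For [n > 0] and [p > 0], the first [p] factors multiplying
    the [lam k] add up to min(p + 1, n), so Abel summation reduces to the bounds for [p]
    brackets. *)
Lemma sum_sqr_lie_bracket_orthogonal (R : realType) (N n : nat) (A : 'M[R]_n)
    (B : 'I_N -> 'M[R]_n) (lam : nat -> R) :
    A^T = A -> (forall k, (B k)^T = B k) ->
    (forall k, lam k.+1 <= lam k) -> 0 <= lam N ->
    (forall k l, mxinner (B k) (B l) = lam k *+ (k == l)) ->
  \sum_k mxnorm (lie_bracket A (B k)) ^+ 2
    <= mxinner A A * \sum_(k < N) lam k * ((k == 0 :> nat)%:R + (k.+1 < n)%:R).
Proof.
move=> symA symB lam_dec lamN BB.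
(* [Q k = 0] when [lam k = 0], since then [(Num.sqrt 0)^-1 = 0]. *)
pose Q (k : 'I_N) := (Num.sqrt (lam k))^-1 *: B k.
have lam_ge0 (k : 'I_N) : 0 <= lam k.
  by have := mxinner_ge0 (B k); rewrite BB eqxx.
have BQ (k : 'I_N) : B k = Num.sqrt (lam k) *: Q k.
  have [lk0|lk0] := eqVneq (lam k) 0; last first.
    by rewrite scalerA mulfV ?scale1r // gt_eqF // sqrtr_gt0 lt0r lk0 lam_ge0.
  by rewrite lk0 sqrtr0 scale0r; apply: mxinner_eq0; rewrite BB lk0 mul0rn.
have orthoQ k l : k != l -> mxinner (Q k) (Q l) = 0.
  by move=> /negPf kl; rewrite mxinnerZl mxinnerZr BB kl !mulr0.
have unitQ k : mxinner (Q k) (Q k) <= 1.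
  rewrite mxinnerZl mxinnerZr BB eqxx mulrA -invfM -expr2 sqr_sqrtr //.
  by have [->|lk] := eqVneq (lam k) 0; rewrite ?mulr0 ?ler01 // mulVf.
have symQ k : (Q k)^T = Q k by rewrite linearZ /= symB.
pose X := mxinner A A; have X0 : 0 <= X := mxinner_ge0 A.
pose s k := mxnorm (lie_bracket A (Q k)) ^+ 2.
rewrite mulr_sumr -subr_ge0 -sumrB.
pose r (k : 'I_N) := X * ((k == 0 :> nat)%:R + (k.+1 < n)%:R) - s k.
have -> : \sum_(k < N) (X * (lam k * ((k == 0 :> nat)%:R + (k.+1 < n)%:R))
    - mxnorm (lie_bracket A (B k)) ^+ 2) = \sum_(k < N) lam k * r k.
  apply: eq_bigr => k _; rewrite /r mulrBr mulrCA; congr (_ - _).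
  rewrite /s BQ lie_bracketZr !sqr_mxnorm mxinnerZl mxinnerZr mulrA -expr2.
  by rewrite sqr_sqrtr.
apply: abel_sum_ge0 => // p pN; rewrite sumrB subr_ge0 -mulr_sumr.
have [Sp Sn] :=
  sum_sqr_lie_bracket_le (fun k : 'I_N => (k < p)%N) symA symQ orthoQ unitQ.
rewrite -(big_ord_widen _ (fun k => (k == 0)%:R + (k.+1 < n)%:R)) //.
have -> : \sum_(k < p) ((k == 0 :> nat)%:R + (k.+1 < n)%:R) =
    ((0 < p) + minn p n.-1)%:R :> R.
  elim: (p) => [|q IHq]; first by rewrite big_ord0 min0n.
  rewrite big_ord_recr IHq /=.
  have -> : (1 + minn q.+1 n.-1 =
      (0 < q) + minn q n.-1 + ((q == 0) + (q.+1 < n)))%N by lia.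
  by rewrite (natrD _ (_ + _)) (natrD _ (q == 0)).
have [->|p_gt0] := posnP p; first by rewrite big_pred0 ?min0n ?mulr0.
have cardp : #|(fun k : 'I_N => (k < p)%N)| = p.
  by rewrite -sum1_card -(big_ord_widen _ (fun=> 1%N)) // sum1_card card_ord.
(* For [p <= n.-1] the bound [p + 1] is used, otherwise the bound [n]. *)
rewrite mulrC; have [pn|np] := leqP p n.-1.
  by move: Sp; rewrite cardp natrD addrC.
apply: le_trans Sn _; rewrite ler_wpM2r // ler_nat; lia.
Qed.

(* Indices start at 0: u`_0, lam`_0, lam`_1 are u_1, lambda_1, lambda_2.
   Since nth defaults to 0, lam`_i = 0 for every i >= m, which is the
   convention lambda_alpha := 0 for alpha > m. *)
Theorem theorem2p6 (R : realType) (m n : nat) (W : vectType R)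
    (dot : {dot W for idfun}) (F : {linear W -> 'M[R]_n})
    (w u : m.-tuple W) (lam : m.-tuple R) :
  \dim {:W} = m ->
  (0 < m)%N ->
  (forall x : W, F x \in sym0mx) ->
  orthonormal_basis dot w ->
  sorted_eigenvalues (fundamental_mx F w) lam ->
  orthonormal_basis dot u ->
  mxinner (F u`_0) (F u`_0) = lam`_0 ->
  \sum_(1 <= a < m) mxnorm (lie_bracket (F u`_0) (F u`_a)) ^+ 2
    <= lam`_0 * (lam`_1 + \sum_(1 <= a < minn m n) lam`_a).
Proof.
case: m w u lam => [|m] w u lam _ // _ symF bw /andP[sl /eqP chw] bu A00.
have [O OO fundE] := fundamental_mx_conj F bw bu.
pose M : 'M[R]_(1 + m) := fundamental_mx F u.
have MijE (a b : 'I_m.+1) : M a b = mxinner (F u`_a) (F u`_b).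
  by rewrite mxE !(tnth_nth 0).
have [||||P PP PM] := @tail_diagonalization _ _ M lam.
- exact: fundamental_mx_sym.
- exact: sl.
- by rewrite /M fundE char_poly_conj.
- by rewrite MijE.
have symA x : (F x)^T = F x by have /andP[/eqP] := symF x.
(* [A a] is A_(a+2) of the statement; rotating by [P] makes the family orthogonal with squared norms
   lambda_2, ..., lambda_m. *)
pose A (a : 'I_m) := F u`_a.+1.
pose B b := \sum_a P b a *: A a.
have BB k l : mxinner (B k) (B l) = lam`_k.+1 *+ (k == l).
  have -> : lam`_k.+1 *+ (k == l) = (P *m drsubmx M *m P^T) k l.
    by rewrite PM !mxE.
  rewrite mxinner_sumr mxE; apply: eq_bigr => b _.
  rewrite mxinnerZr mxinner_suml mxE mulrC [P^T _ _]mxE; congr (_ * _).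
  apply: eq_bigr => a _; rewrite mxinnerZl [drsubmx _ _ _]mxE [dsubmx _ _ _]mxE.
  by rewrite MijE.
rewrite big_add1 big_mkord.
have -> : \sum_(a < m) mxnorm (lie_bracket (F u`_0) (F u`_a.+1)) ^+ 2 =
    \sum_(b < m) mxnorm (lie_bracket (F u`_0) (B b)) ^+ 2.
  rewrite (sum_sqr_mxnorm_orthogonal _ PP); apply: eq_bigr => b _.
  rewrite lie_bracket_sumr; congr (mxnorm _ ^+ 2).
  by apply: eq_bigr => a _; rewrite lie_bracketZr.
have := @sum_sqr_lie_bracket_orthogonal _ m n (F u`_0) B (fun k => lam`_k.+1).
rewrite A00.
have -> : \sum_(k < m) lam`_k.+1 * ((k == 0 :> nat)%:R + (k.+1 < n)%:R)
    = lam`_1 + \sum_(1 <= a < minn m.+1 n) lam`_a.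
  under eq_bigr do rewrite mulrDr.
  rewrite big_split /=; congr (_ + _).
    (* The summand [k = 0] supplies the extra lambda_2; for a one-dimensional [W] that is the
       default value 0. *)
    case: (m) lam {sl chw A00 PM BB} => [|m'] lam'.
      by rewrite big_ord0 nth_default ?size_tuple.
    rewrite big_ord_recl eqxx mulr1 big1 ?addr0 // => k _.
    by rewrite mulr0.
  rewrite (big_nat_widen _ _ _ _ _ (geq_minl _ _)) big_add1 big_mkord.
  rewrite [RHS]big_mkcond.
  apply: eq_bigr => k _; rewrite /= leq_min ltnS ltn_ord /=.
  by case: ltnP; rewrite ?mulr1 ?mulr0.
apply => //.
- by move=> k; rewrite linear_sum; apply: eq_bigr => a _; rewrite linearZ /= symA.
(* Past the end of [lam] entries default to 0, so the last eigenvalue must be nonnegative: it is the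
   squared norm of some [B k]. *)
- move=> k; have [km|mk] := ltnP k.+2 m.+1; last first.
    rewrite [lam`_k.+2]nth_default ?size_tuple //.
    have [km'|mk'] := ltnP k m; last by rewrite nth_default ?size_tuple.
    by have := mxinner_ge0 (B (Ordinal km')); rewrite BB eqxx.
  apply: (sorted_leq_nth ge_trans (@lexx _ _)) => //.
    by rewrite inE size_tuple ltnW.
  by rewrite inE size_tuple.
- by rewrite nth_default ?size_tuple.
Qed.
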